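(* Let $f(\mathbf{x})=\mathcal{A}^h_f\mathbf{x}^d$ be a homogeneous polynomial of degree $d$ in $n$ variables with symmetric coefficient tensor $\mathcal{A}^h_f\in S^{d,n}$, and let $F=\{\mathbf{x}\in\mathbb{R}^n : B\mathbf{x}\le\mathbf{b},\ \mathbf{x}\ge\mathbf{0}\}$ with $B\in\mathbb{R}^{m\times n}$, $\mathbf{b}\in\mathbb{R}^m$. Let $\alpha\in\mathbb{R}^n_+$ be such that $\alpha^\top\mathbf{x}\le 1$ for all $\mathbf{x}\in F$, put $\mathbf{a}=(\alpha^\top,1)^\top\in\mathbb{R}^{n+1}_+$ and $$A=\begin{pmatrix}\mathbf{b}\mathbf{a}^\top-(B,\mathbf{0})\\ I_{n+1}\end{pmatrix}\in\mathbb{R}^{(m+n+1)\times(n+1)}.$$ Let $\bar{\mathcal{A}}\in S^{d,n+1}$ be the tensor obtained from $\mathcal{A}^h_f$ by zero padding. Assume the problem $\min\{f(\mathbf{x}) : \mathbf{x}\in F\}$ has an optimal solution. Then it is equivalent (in the sense of sharing the same optimal value) to the completely positive optimization problem $$\min\ \langle\bar{\mathcal{A}},\mathcal{X}\rangle\quad\text{s.t.}\quad \mathcal{X}\in\mathcal{C}^*_{n+1,d},\ \ \langle\mathcal{X},M_d(\mathbf{a})\rangle=1,\ \ \mathcal{X}_{\times 1}A_{\times 2}A\cdots_{\times d}A\in\mathcal{C}^*_{m+n+1,d}.$$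
   Context: $d,n,m$ are positive integers. $S^{d,p}$ is the set of real symmetric tensors of order $d$ and dimension $p$, with inner product $\langle\mathcal{A},\mathcal{B}\rangle=\sum a_{i_1\cdots i_d}b_{i_1\cdots i_d}$. For $\mathbf{z}\in\mathbb{R}^p$, $M_d(\mathbf{z})\in S^{d,p}$ is the tensor with entries $z_{i_1}\cdots z_{i_d}$, and $\mathcal{A}\mathbf{z}^d=\langle\mathcal{A},M_d(\mathbf{z})\rangle$. The completely positive tensor cone is $\mathcal{C}^*_{p,d}=\{\sum_{i=1}^kM_d(\mathbf{z}_i) : k\in\mathbb{N},\ \mathbf{z}_i\in\mathbb{R}^p_+\}\subseteq S^{d,p}$. For $\mathcal{X}\in S^{d,q}$ and $D\in\mathbb{R}^{p\times q}$, $\mathcal{X}_{\times 1}D\cdots_{\times d}D$ is the order-$d$, dimension-$p$ tensor with entries $\sum_{j_1,\ldots,j_d\in[q]}\mathcal{X}_{j_1\cdots j_d}D_{i_1j_1}\cdots D_{i_dj_d}$. $(B,\mathbf{0})\in\mathbb{R}^{m\times(n+1)}$ is $B$ with a zero column appended; $I_{n+1}$ is the identity matrix. Zero padding: $\bar{a}_{i_1\cdots i_d}=a_{i_1\cdots i_d}$ if $i_1,\ldots,i_d\in[n]$ and $0$ otherwise, where $\mathcal{A}^h_f=(a_{i_1\cdots i_d})$. *)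

(* Defs.v *)
From mathcomp Require Import all_boot all_order all_fingroup all_algebra.
From mathcomp Require Import classical_sets reals.

Set Implicit Arguments.
Unset Strict Implicit.
Unset Printing Implicit Defensive.

Import Order.TTheory GRing.Theory Num.Theory.
Local Open Scope classical_set_scope.
Local Open Scope ring_scope.

(** A multi-index (i_1, ..., i_d) in [p]^d is a finite function from 'I_d to
    'I_p. *)
Notation tensor R d p := {ffun {ffun 'I_d -> 'I_p} -> R}.

Definition sym_tensor (R : realType) (d p : nat) : set (tensor R d p) :=
  [set T | forall (s : 'S_d) (i : {ffun 'I_d -> 'I_p}),
     T [ffun k => i (s k)] = T i].

Definition tdot (R : realType) (d p : nat) (S T : tensor R d p) : R :=
  \sum_i S i * T i.

Definition Mtensor (R : realType) (d p : nat) (z : 'cV[R]_p) : tensor R d p :=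
  [ffun i : {ffun 'I_d -> 'I_p} => \prod_(k < d) z (i k) 0].

Arguments Mtensor {R} d {p} z.

Definition tform (R : realType) (d p : nat) (T : tensor R d p)
    (z : 'cV[R]_p) : R :=
  tdot T (Mtensor d z).

Definition vle (R : realType) (p : nat) (x y : 'cV[R]_p) : Prop :=
  forall i, x i 0 <= y i 0.

Definition cp_cone (R : realType) (d p : nat) : set (tensor R d p) :=
  [set T | exists (k : nat) (z : 'I_k -> 'cV[R]_p),
     (forall i, vle 0 (z i)) /\
     T = \sum_(i < k) Mtensor d (z i)].

(** X times_1 D ... times_d D. *)
Definition tmodes (R : realType) (d p q : nat) (X : tensor R d q)
    (D : 'M[R]_(p, q)) : tensor R d p :=
  [ffun i : {ffun 'I_d -> 'I_p} =>
     \sum_(j : {ffun 'I_d -> 'I_q}) X j * \prod_(k < d) D (i k) (j k)].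

(** [n] is embedded in [n+1] by lshift; the multi-index j below is unique when
    it exists, and it exists iff all components of i are less than n. *)
Definition zero_pad (R : realType) (d n : nat) (T : tensor R d n) :
    tensor R d (n + 1) :=
  [ffun i : {ffun 'I_d -> 'I_(n + 1)} =>
     if [pick j : {ffun 'I_d -> 'I_n} | i == [ffun k => lshift 1 (j k)]]
       is Some j then T j else 0 : R].

Definition polyhedron (R : realType) (m n : nat) (B : 'M[R]_(m, n))
    (b : 'cV[R]_m) : set 'cV[R]_n :=
  [set x | vle (B *m x) b /\ vle 0 x].

Definition avec (R : realType) (n : nat) (alpha : 'cV[R]_n) : 'cV[R]_(n + 1) :=
  col_mx alpha (const_mx 1).

Definition Amx (R : realType) (m n : nat) (B : 'M[R]_(m, n)) (b : 'cV[R]_m)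
    (alpha : 'cV[R]_n) : 'M[R]_(m + (n + 1), n + 1) :=
  col_mx (b *m (avec alpha)^T - row_mx B (0 : 'cV[R]_m)) 1%:M.

Definition cp_feasible (R : realType) (d p q : nat) (a : 'cV[R]_p)
    (A : 'M[R]_(q, p)) : set (tensor R d p) :=
  [set X | [/\ cp_cone X, tdot X (Mtensor d a) = 1 & cp_cone (tmodes X A)]].

Definition optimal_solution (R : realType) (V : Type) (obj : V -> R)
    (feas : set V) (x : V) : Prop :=
  feas x /\ forall y, feas y -> obj x <= obj y.

(** The value of a minimization problem is a minimum, not just an infimum. *)
Definition optimal_value (R : realType) (V : Type) (obj : V -> R)
    (feas : set V) (v : R) : Prop :=
  exists2 x, optimal_solution obj feas x & obj x = v.

(* Main.v *)
Require Import Defs.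
From mathcomp Require Import all_boot all_order all_algebra.
From mathcomp Require Import classical_sets reals.
From mathcomp Require Import lra.

Set Implicit Arguments.
Unset Strict Implicit.
Unset Printing Implicit Defensive.

Import Order.TTheory GRing.Theory Num.Theory.
Local Open Scope classical_set_scope.
Local Open Scope ring_scope.

(** A feasible point x of the polyhedron gives the feasible tensor M_d(z0),
    where z0 = (x, 1 - alpha^T x): the slack makes a^T z0 = 1, hence
    A z0 = (b - B x, z0) >= 0, and the padded objective sees only the first n
    coordinates of z0.  So the conic optimal value is at most min f.

    For the converse, the two cone conditions provide two unrelated
    decompositions, X = sum_i M_d(z_i) and X x_1 A ... x_d A = sum_j M_d(w_j).
    The point is that every w_j lies in the range of A.  Indeed, if u^T A = 0
    and d >= 2, contracting sum_i M_d(A z_i) = sum_j M_d(w_j) with u in two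
    modes and with the all-ones vector in the others gives
      0 = sum_j (u^T w_j)^2 (1^T w_j)^(d-2),
    a sum of nonnegative terms, so u^T w_j = 0 for all j
    ([sum_Mtensor_orthogonal]).  As A ends with an identity block, this means
    w_j = A y_j where y_j >= 0 is the lower block of w_j, and then
    X = sum_j M_d(y_j): a single decomposition with y_j >= 0 and A y_j >= 0
    ([cp_factor_simultaneous]).  If d = 1 the vectors can simply be added.

    With y_j = (x_j, s_j) and t_j = a^T y_j >= 0, the condition A y_j >= 0 says
    x_j >= 0 and B x_j <= t_j b.  Such a pair (x_j, t_j) satisfies
    f(x_j) >= (min f) t_j^d ([tform_ge_cone]), and summing over j with
    sum_j t_j^d = 1 gives the bound. *)

(** * Contractions of rank-one tensors *)

Definition tprod (R : realType) (d p : nat) (v : 'I_d -> 'cV[R]_p) :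
    tensor R d p :=
  [ffun i : {ffun 'I_d -> 'I_p} => \prod_(k < d) v k (i k) 0].

Lemma Mtensor_tprod (R : realType) (d p : nat) (z : 'cV[R]_p) :
  Mtensor d z = tprod (fun _ : 'I_d => z).
Proof. by []. Qed.

Lemma tdot_tprod (R : realType) (d p : nat) (v w : 'I_d -> 'cV[R]_p) :
  tdot (tprod v) (tprod w) = \prod_(k < d) ((v k)^T *m w k) 0 0.
Proof.
under [RHS]eq_bigr => k _.
  rewrite mxE; under eq_bigr => i _ do rewrite mxE.
  over.
rewrite bigA_distr_bigA; apply: eq_bigr => i _.
by rewrite !ffunE -big_split.
Qed.

Lemma tdot_Mtensor (R : realType) (d p : nat) (z a : 'cV[R]_p) :
  tdot (Mtensor d z) (Mtensor d a) = (a^T *m z) 0 0 ^+ d.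
Proof.
rewrite !Mtensor_tprod tdot_tprod prodr_const card_ord.
by congr (_ ^+ _); rewrite -[a^T *m z]trmxK trmx_mul trmxK [RHS]mxE.
Qed.

Lemma tdot_suml (R : realType) (d p k : nat) (F : 'I_k -> tensor R d p)
    (T : tensor R d p) :
  tdot (\sum_j F j) T = \sum_j tdot (F j) T.
Proof.
rewrite exchange_big; apply: eq_bigr => i _.
by rewrite sum_ffunE mulr_suml.
Qed.

Lemma tdot_sumr (R : realType) (d p k : nat) (T : tensor R d p)
    (F : 'I_k -> tensor R d p) :
  tdot T (\sum_j F j) = \sum_j tdot T (F j).
Proof.
rewrite exchange_big; apply: eq_bigr => i _.
by rewrite sum_ffunE mulr_sumr.
Qed.

Lemma tmodes_sum (R : realType) (d p q k : nat) (F : 'I_k -> tensor R d q)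
    (D : 'M[R]_(p, q)) :
  tmodes (\sum_j F j) D = \sum_j tmodes (F j) D.
Proof.
apply/ffunP => i; rewrite sum_ffunE ffunE.
under [RHS]eq_bigr => j _ do rewrite ffunE.
rewrite exchange_big; apply: eq_bigr => l _.
by rewrite sum_ffunE mulr_suml.
Qed.

Lemma tmodes_Mtensor (R : realType) (d p q : nat) (z : 'cV[R]_q)
    (D : 'M[R]_(p, q)) :
  tmodes (Mtensor d z) D = Mtensor d (D *m z).
Proof.
apply/ffunP => i; rewrite !ffunE.
under [RHS]eq_bigr => k _ do rewrite mxE.
rewrite bigA_distr_bigA; apply: eq_bigr => j _.
by rewrite ffunE mulrC -big_split.
Qed.

Lemma Mtensor1_sum (R : realType) (p k : nat) (z : 'I_k -> 'cV[R]_p) :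
  \sum_j Mtensor 1 (z j) = Mtensor 1 (\sum_j z j).
Proof.
apply/ffunP => i; rewrite sum_ffunE ffunE big_ord1 summxE.
by apply: eq_bigr => j _; rewrite ffunE big_ord1.
Qed.

Lemma Mtensor1_inj (R : realType) (p : nat) :
  injective (@Mtensor R 1 p).
Proof.
move=> y z /ffunP yz; apply/matrixP => i j.
by have := yz [ffun=> i]; rewrite !ffunE !big_ord1 !ffunE !ord1.
Qed.

Lemma vle0_sum (R : realType) (p k : nat) (z : 'I_k -> 'cV[R]_p) :
  (forall j, vle 0 (z j)) -> vle 0 (\sum_j z j).
Proof.
move=> z0 i; rewrite mxE summxE; apply: sumr_ge0 => j _.
by have := z0 j i; rewrite mxE.
Qed.

Lemma vle0_mul (R : realType) (p : nat) (a z : 'cV[R]_p) :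
  vle 0 a -> vle 0 z -> 0 <= (a^T *m z) 0 0.
Proof.
move=> a0 z0; rewrite mxE; apply: sumr_ge0 => i _; rewrite mxE.
by have := a0 i; have := z0 i; rewrite mxE => ? ?; apply: mulr_ge0.
Qed.

(** * A decomposition compatible with both cone conditions *)

(** The order is at least 2 so that u can be used in two modes: the square makes
    all terms of the contracted identity nonnegative, whatever the parity of the
    order. *)
Lemma sum_Mtensor_orthogonal (R : realType) (e p k l : nat)
    (z : 'I_k -> 'cV[R]_p) (w : 'I_l -> 'cV[R]_p) (u : 'cV[R]_p) :
  \sum_i Mtensor e.+2 (z i) = \sum_j Mtensor e.+2 (w j) ->
  (forall i, u^T *m z i = 0) -> (forall j, vle 0 (w j)) ->
  forall j, u^T *m w j = 0.
Proof.
move=> zw uz w0 j.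
pose one : 'cV[R]_p := const_mx 1.
pose v (c : 'I_e.+2) := if (c < 2)%N then u else one.
have contractE y : tdot (tprod v) (Mtensor e.+2 y) =
    (u^T *m y) 0 0 ^+ 2 * (one^T *m y) 0 0 ^+ e.
  rewrite Mtensor_tprod tdot_tprod !big_ord_recl /= mulrA; congr (_ * _).
  by rewrite -[in RHS](card_ord e) -prodr_const; apply: eq_bigr.
have one_ge0 : vle 0 one by move=> i; rewrite !mxE.
have /psumr_eq0P sum0 : \sum_j (u^T *m w j) 0 0 ^+ 2 * (one^T *m w j) 0 0 ^+ e = 0.
  under eq_bigr => i _ do rewrite -contractE.
  rewrite -tdot_sumr -zw tdot_sumr big1 // => i _.
  by rewrite contractE uz mxE expr0n mul0r.
have /eqP : (u^T *m w j) 0 0 ^+ 2 * (one^T *m w j) 0 0 ^+ e = 0.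
  apply: sum0 => // i _; apply: mulr_ge0; first exact: sqr_ge0.
  by apply: exprn_ge0; apply: vle0_mul.
rewrite mulf_eq0 => /orP[|].
  rewrite expf_eq0 /= => /eqP h; apply/matrixP => r s.
  by rewrite !ord1 h mxE.
(* A nonnegative vector orthogonal to the all-ones vector is zero. *)
rewrite expf_eq0 => /andP[_ /eqP]; rewrite mxE => /psumr_eq0P one_w.
suff -> : w j = 0 by rewrite mulmx0.
apply/matrixP => r s; rewrite ord1 [RHS]mxE.
have := one_w _ r isT; rewrite !mxE mul1r; apply => i _.
by rewrite !mxE mul1r; have := w0 j i; rewrite mxE.
Qed.

(** The identity block of the matrix is what makes the lower blocks of the second
    decomposition serve as a decomposition of X itself. *)
Lemma cp_factor_simultaneous (R : realType) (d q p : nat) (P : 'M[R]_(q, p))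
    (X : tensor R d p) :
  (0 < d)%N -> cp_cone X -> cp_cone (tmodes X (col_mx P 1%:M)) ->
  exists (k : nat) (y : 'I_k -> 'cV[R]_p),
    (forall j, vle 0 (y j) /\ vle 0 (P *m y j)) /\ X = \sum_j Mtensor d (y j).
Proof.
set A := col_mx P 1%:M => d_gt0 [k [z [z0 ->]]] [l [w [w0]]].
rewrite tmodes_sum; under eq_bigr => i _ do rewrite tmodes_Mtensor.
case: d {X} d_gt0 => // -[_|e _] zw.
  (* For order 1 the w j need not lie in the range of A, but only their sum
     matters, and it is A times the sum of the z i. *)
  exists 1%N, (fun=> \sum_i z i); rewrite big_ord1 Mtensor1_sum.
  split=> // _; split; first exact: vle0_sum.
  move: zw; rewrite !Mtensor1_sum => /Mtensor1_inj zw i.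
  have := vle0_sum w0 (lshift p i).
  by rewrite -zw -mulmx_sumr mul_col_mx col_mxEu !mxE.
have w_top j : usubmx (w j) = P *m dsubmx (w j).
  apply/matrixP => i s; rewrite ord1 {s}.
  (* The rows of (1, -P) span the left kernel of A. *)
  pose u := (row i (row_mx 1%:M (- P)))^T.
  have uE y : u^T *m y = row i (usubmx y - P *m dsubmx y).
    by rewrite trmxK -row_mul -[y in LHS]vsubmxK mul_row_col mul1mx mulNmx.
  have uz h : u^T *m (A *m z h) = 0.
    by rewrite uE mul_col_mx mul1mx col_mxKu col_mxKd subrr row0.
  have := sum_Mtensor_orthogonal zw uz w0 j; rewrite uE => /matrixP/(_ 0 0).
  by rewrite !mxE => /eqP; rewrite subr_eq0 => /eqP.
exists l, (dsubmx \o w); split=> [j /=|].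
  by split=> i; [|rewrite -w_top]; rewrite !mxE;
     [have := w0 j (rshift q i)|have := w0 j (lshift p i)]; rewrite mxE.
have := congr1 (fun T => tmodes T (row_mx 0 1%:M)) zw.
rewrite !tmodes_sum.
under eq_bigr => i _ do
  rewrite tmodes_Mtensor mul_col_mx mul_row_col mul0mx add0r !mul1mx.
move=> ->; apply: eq_bigr => j _.
by rewrite tmodes_Mtensor -[w j in LHS]vsubmxK mul_row_col mul0mx add0r mul1mx.
Qed.

(** * The homogenized lower bound on the objective *)

Lemma horner0_ge0 (R : realFieldType) (p : {poly R}) :
  (forall e, 0 < e -> 0 <= p.[e]) -> 0 <= p.[0].
Proof.
elim/poly_ind: p => [|q c _] p_ge0; first by rewrite horner0.
rewrite !(hornerE, mulr0, add0r) leNgt; apply/negP => c_lt0.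
have [K qK] := poly_itv_bound q 0 1.
have K_ge0 : 0 <= K by apply: le_trans (qK 0 _) => //; rewrite lexx ler01.
(* With |q| <= K on [0, 1], this e satisfies e * K < - c, so the value at e
   would still be negative. *)
pose e := Num.min 1 (- c / (K + K + 1)).
have e_gt0 : 0 < e by rewrite lt_min ltr01 divr_gt0 //; lra.
have e_le1 : e <= 1 by rewrite ge_min lexx.
have eK : e * (K + K + 1) <= - c.
  by rewrite -ler_pdivlMr ?ge_min ?lexx ?orbT //; lra.
have := p_ge0 e e_gt0; rewrite !hornerE.
have := le_trans (ler_norm _) (qK e _); rewrite (ltW e_gt0) e_le1 => /(_ isT) qe.
nra.
Qed.

Lemma tform_poly (R : realType) (d p : nat) (T : tensor R d p)
    (x y : 'cV[R]_p) :
  exists P : {poly R}, forall e, P.[e] = tform T (x + e *: y).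
Proof.
exists (\sum_i T i *: \prod_(k < d) ((x (i k) 0)%:P + y (i k) 0 *: 'X)) => e.
rewrite horner_sum; apply: eq_bigr => i _.
rewrite hornerZ horner_prod ffunE; congr (_ * _); apply: eq_bigr => k _.
by rewrite !hornerE !mxE mulrC.
Qed.

Lemma tformZ (R : realType) (d p : nat) (T : tensor R d p) (c : R)
    (x : 'cV[R]_p) :
  tform T (c *: x) = c ^+ d * tform T x.
Proof.
rewrite /tform /tdot mulr_sumr; apply: eq_bigr => i _; rewrite mulrCA.
congr (_ * _); rewrite !ffunE; under eq_bigr => k _ do rewrite mxE.
by rewrite big_split prodr_const card_ord.
Qed.

(** For t > 0 this is the bound at the point x / t of the polyhedron.  For t = 0,
    x is a recession direction, and the bound says that a form bounded below on
    the polyhedron cannot be negative along it.  Both cases follow at once by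
    perturbing (x, t) to (x + e x0, t + e), whose quotient lies in the polyhedron
    for every e > 0, and letting e tend to 0 in a polynomial inequality. *)
Lemma tform_ge_cone (R : realType) (d m n : nat) (T : tensor R d n)
    (B : 'M[R]_(m, n)) (b : 'cV[R]_m) (v : R) (x0 : 'cV[R]_n) :
  polyhedron B b x0 ->
  (forall x, polyhedron B b x -> v <= tform T x) ->
  forall (x : 'cV[R]_n) (t : R),
    0 <= t -> vle 0 x -> vle (B *m x) (t *: b) -> v * t ^+ d <= tform T x.
Proof.
move=> [Bx0 x0_ge0] v_min x t t_ge0 x_ge0 Bx.
have [p pE] := tform_poly T x x0.
have {}pE e : (p - v *: (t%:P + 'X) ^+ d).[e] =
    tform T (x + e *: x0) - v * (t + e) ^+ d.
  by rewrite -pE !hornerE.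
suff /horner0_ge0 : forall e, 0 < e -> 0 <= (p - v *: (t%:P + 'X) ^+ d).[e].
  by rewrite pE scale0r !addr0 subr_ge0.
move=> e e_gt0; have te_gt0 : 0 < t + e by lra.
rewrite pE subr_ge0.
set y := (x + e *: x0); pose c := (t + e)^-1.
have c_gt0 : 0 < c by rewrite invr_gt0.
have -> : y = (t + e) *: (c *: y) by rewrite scalerA divff ?scale1r ?gt_eqF.
rewrite tformZ mulrC ler_pM2l ?exprn_gt0 //; apply: v_min; split=> i.
  rewrite -scalemxAr mxE ler_pdivrMl // mulmxDr -scalemxAr [leLHS]mxE mulrDl.
  rewrite [X in _ + X <= _]mxE lerD ?ler_pM2l //.
  by have := Bx i; rewrite [leRHS]mxE.
rewrite !mxE; apply: mulr_ge0; first exact: ltW.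
have := x_ge0 i; have := x0_ge0 i; rewrite !mxE => *.
by rewrite addr_ge0 // mulr_ge0 // ltW.
Qed.

(** * The data of the completely positive program *)

Lemma tdot_zero_pad (R : realType) (d n : nat) (T : tensor R d n)
    (z : 'cV[R]_(n + 1)) :
  tdot (zero_pad T) (Mtensor d z) = tform T (usubmx z).
Proof.
pose emb (j : {ffun 'I_d -> 'I_n}) : {ffun 'I_d -> 'I_(n + 1)} :=
  [ffun k => lshift 1 (j k)].
have emb_inj : injective emb.
  move=> j j' /ffunP h; apply/ffunP => k; apply: (@lshift_inj _ 1).
  by have := h k; rewrite !ffunE.
have padE i : zero_pad T i = \sum_(j | emb j == i) T j.
  rewrite ffunE; case: pickP => [j /eqP ->|no_j].
    by rewrite (big_pred1 j) // => j'; rewrite (inj_eq emb_inj).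
  by rewrite big_pred0 // => j; rewrite eq_sym; apply: no_j.
rewrite /tdot; under eq_bigr => i _ do rewrite padE mulr_suml.
rewrite (exchange_big_dep xpredT) //=; apply: eq_bigr => j _.
rewrite (big_pred1 (emb j)) => [|i]; last by rewrite eq_sym.
by congr (_ * _); rewrite !ffunE; apply: eq_bigr => k _; rewrite mxE ffunE.
Qed.

Lemma mul_Amx_top (R : realType) (m n : nat) (B : 'M[R]_(m, n))
    (b : 'cV[R]_m) (a z : 'cV[R]_(n + 1)) :
  (b *m a^T - row_mx B (0 : 'cV[R]_m)) *m z =
  (a^T *m z) 0 0 *: b - B *m usubmx z.
Proof.
rewrite mulmxBl -mulmxA -[z in row_mx _ _ *m z]vsubmxK mul_row_col mul0mx addr0.
by rewrite [a^T *m z in LHS]mx11_scalar mul_mx_scalar.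
Qed.

Theorem theorem5 (R : realType) (d n m : nat)
    (hd : (0 < d)%N) (hn : (0 < n)%N) (hm : (0 < m)%N)
    (Af : tensor R d n) (hAf : sym_tensor Af)
    (f : 'cV[R]_n -> R) (hf : forall x, f x = tform Af x)
    (B : 'M[R]_(m, n)) (b : 'cV[R]_m)
    (alpha : 'cV[R]_n) (halpha : vle 0 alpha)
    (halphaF : forall x, polyhedron B b x -> (alpha^T *m x) 0 0 <= 1)
    (hopt : exists x, optimal_solution f (polyhedron B b) x) :
  exists v : R,
    optimal_value f (polyhedron B b) v /\
    optimal_value (fun X : tensor R d (n + 1) => tdot (zero_pad Af) X)
      (cp_feasible (avec alpha) (Amx B b alpha)) v.
Proof.
have [x0 [Fx0 x0_min]] := hopt; have [Bx0 x0_ge0] := Fx0.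
exists (f x0); split; first by exists x0.
have a_ge0 : vle 0 (avec alpha).
  move=> i; case: (split_ordP i) => j ->; rewrite mxE.
    by rewrite col_mxEu; have := halpha j; rewrite mxE.
  by rewrite col_mxEd mxE.
pose s : 'cV[R]_1 := const_mx (1 - (alpha^T *m x0) 0 0).
pose z0 := col_mx x0 s.
have az0 : ((avec alpha)^T *m z0) 0 0 = 1.
  rewrite tr_col_mx mul_row_col mxE [X in _ + X]mxE big_ord1 !mxE mul1r.
  lra.
have z0_ge0 : vle 0 z0.
  move=> i; rewrite mxE; case: (split_ordP i) => j ->.
    by rewrite col_mxEu; have := x0_ge0 j; rewrite mxE.
  by rewrite col_mxEd mxE subr_ge0; apply: halphaF.
have obj_z0 : tdot (zero_pad Af) (Mtensor d z0) = f x0.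
  by rewrite tdot_zero_pad col_mxKu hf.
exists (Mtensor d z0) => //; split.
  split.
  - by exists 1%N, (fun=> z0); rewrite big_ord1.
  - by rewrite tdot_Mtensor az0 expr1n.
  - rewrite tmodes_Mtensor.
    exists 1%N, (fun=> Amx B b alpha *m z0); rewrite big_ord1; split=> // _ i.
    rewrite mul_col_mx mul_Amx_top az0 scale1r col_mxKu mul1mx.
    case: (split_ordP i) => j ->; rewrite ?col_mxEu ?col_mxEd mxE; last first.
      by have := z0_ge0 (j); rewrite mxE.
    by rewrite !mxE subr_ge0; have := Bx0 j; rewrite mxE.
move=> X [cpX aX cpAX]; rewrite obj_z0.
have [k [y [y_ge0 XE]]] := cp_factor_simultaneous hd cpX cpAX.
have x0_min' x : polyhedron B b x -> f x0 <= tform Af x.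
  by rewrite -hf; apply: x0_min.
have -> : f x0 = \sum_j f x0 * ((avec alpha)^T *m y j) 0 0 ^+ d.
  rewrite -mulr_sumr -[LHS]mulr1 -aX XE tdot_suml.
  by congr (_ * _); apply: eq_bigr => j _; rewrite tdot_Mtensor.
rewrite XE tdot_sumr; apply: ler_sum => j _; rewrite tdot_zero_pad.
have [yj_ge0 Pyj_ge0] := y_ge0 j.
apply: (tform_ge_cone Fx0 x0_min'); first exact: vle0_mul.
  by move=> i; have := yj_ge0 (lshift 1 i); rewrite !mxE.
move=> i; have := Pyj_ge0 i.
by rewrite mul_Amx_top [leLHS]mxE [leRHS]mxE [X in _ + X]mxE subr_ge0.
Qed.
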